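(* Let $n\ge 2$ be an integer. (i) Let $A=(a_1,\ldots,a_n)\in\mathbb{Z}^{1\times n}$ with all $a_i\in\mathbb{Z}_{>0}$ and $\gcd(a_1,\ldots,a_n)=1$, and let $\boldsymbol c\in\mathbb{Q}^n$. Suppose that $(A,\boldsymbol c)$ is generic. Then for $\tau=\tau(A,\boldsymbol c)$ and $\boldsymbol l=\boldsymbol l(A,\boldsymbol c)=(l_1,\ldots,l_{n-1})$ we have $$\mathrm{Gap}_{\boldsymbol c}(A)\ge \rho_{n-1}\left(|A_\tau|\, l_1\cdots l_{n-1}\right)^{1/(n-1)}-\|\boldsymbol l\|_1 .$$ (ii) For any $\epsilon>0$ there exist $A=(a_1,\ldots,a_n)\in\mathbb{Z}^{1\times n}$ with all $a_i\in\mathbb{Z}_{>0}$ and $\gcd(a_1,\ldots,a_n)=1$, and $\boldsymbol c\in\mathbb{Q}^n$, such that $(A,\boldsymbol c)$ is generic and, with $\tau=\tau(A,\boldsymbol c)$ and $\boldsymbol l=\boldsymbol l(A,\boldsymbol c)$, $$\mathrm{Gap}_{\boldsymbol c}(A)< (\rho_{n-1}+\epsilon)\left(|A_\tau|\, l_1\cdots l_{n-1}\right)^{1/(n-1)}-\|\boldsymbol l\|_1 .$$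
   Context: For $A=(a_1,\ldots,a_n)\in\mathbb{Z}^{1\times n}$ with positive entries, $b\in\mathbb{Z}$ and $\boldsymbol c\in\mathbb{Q}^n$, let $IP_{\boldsymbol c}(A,b)=\min\{\boldsymbol c\cdot\boldsymbol x: A\boldsymbol x=b,\ \boldsymbol x\in\mathbb{Z}^n_{\ge0}\}$ and $LP_{\boldsymbol c}(A,b)=\min\{\boldsymbol c\cdot\boldsymbol x: A\boldsymbol x=b,\ \boldsymbol x\in\mathbb{R}^n_{\ge0}\}$. When the integer problem is feasible and bounded, $IG_{\boldsymbol c}(A,b)=IP_{\boldsymbol c}(A,b)-LP_{\boldsymbol c}(A,b)$. The integer programming gap is $\mathrm{Gap}_{\boldsymbol c}(A)=\max_b IG_{\boldsymbol c}(A,b)$, where $b$ ranges over all integers for which the integer problem is feasible and bounded. The tuple $(A,\boldsymbol c)$ is generic if for every positive $b\in\mathbb{Z}$ the linear program defining $LP_{\boldsymbol c}(A,b)$ has a unique optimal solution. In that case $\tau=\tau(A,\boldsymbol c)\in\{1,\ldots,n\}$ denotes the unique index of the basic (nonzero) variable of this optimal solution for positive $b$ (it does not depend on $b$); $A_\tau=a_\tau$ and $\boldsymbol c_\tau=c_\tau$ are the corresponding entries, and $A_{\bar\tau}$, $\boldsymbol c_{\bar\tau}$ are the vectors of the remaining $n-1$ entries of $A$ and $\boldsymbol c$. Put $\boldsymbol l(A,\boldsymbol c)=\boldsymbol c_{\bar\tau}-\boldsymbol c_\tau A_\tau^{-1}A_{\bar\tau}$, i.e. the vector in $\mathbb{Q}^{n-1}$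 with entries $c_j-c_\tau a_j/a_\tau$, $j\ne\tau$; all its entries are positive when $(A,\boldsymbol c)$ is generic. $\|\cdot\|_1$ is the $l_1$-norm. For $d\ge1$ let $\Delta=\{\boldsymbol x\in\mathbb{R}^d_{\ge0}: x_1+\cdots+x_d\le1\}$ be the standard $d$-dimensional simplex. For a $d$-dimensional lattice $\Lambda\subset\mathbb{R}^d$ the covering radius is $\mu(\Delta,\Lambda)=\min\{\mu>0:\mathbb{R}^d=\mu\Delta+\Lambda\}$. The covering constant is $\rho_d=\inf\{\mu(\Delta,\Lambda):\Lambda\subset\mathbb{R}^d \text{ a } d\text{-dimensional lattice with } \det(\Lambda)=1\}$. *)

(* Defs.v *)
From HB Require Import structures.
From mathcomp Require Export all_boot all_order all_algebra.
From mathcomp Require Export classical_sets reals exp.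

Set Implicit Arguments.
Unset Strict Implicit.
Unset Printing Implicit Defensive.

Import Order.TTheory GRing.Theory Num.Theory.

Local Open Scope classical_set_scope.
Local Open Scope ring_scope.

(* The value is 0 when S has no least (resp. greatest) element. *)
Definition minimum (T : numDomainType) (S : set T) : T :=
  xget 0 [set m | S m /\ lbound S m].
Definition maximum (T : numDomainType) (S : set T) : T :=
  xget 0 [set m | S m /\ ubound S m].

Section IntegerProgramming.
Context {n : nat}.
Implicit Types (A : 'rV[int]_n) (c : 'rV[rat]_n) (b : int).

Definition ip_feasible A b : set 'cV[int]_n :=
  [set x | A *m x = b%:M /\ forall i, 0 <= x i 0].

Definition ip_values c A b : set rat :=
  [set (c *m map_mx intr x) 0 0 | x in ip_feasible A b].

Definition IP c A b : rat := minimum (ip_values c A b).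

Definition lp_feasible {R : realType} A b : set 'cV[R]_n :=
  [set x | map_mx intr A *m x = (b%:~R)%:M /\ forall i, 0 <= x i 0].

Definition lp_objective (R : realType) c (x : 'cV[R]_n) : R :=
  (map_mx ratr c *m x) 0 0.

Definition LP (R : realType) c A b : R :=
  minimum [set lp_objective c x | x in @lp_feasible R A b].

Definition lp_optimal (R : realType) c A b (x : 'cV[R]_n) : Prop :=
  lp_feasible A b x /\
  forall y, lp_feasible A b y -> lp_objective c x <= lp_objective c y.

Definition IG (R : realType) c A b : R := ratr (IP c A b) - LP R c A b.

Definition Gap (R : realType) c A : R :=
  maximum [set IG R c A b | b in
    [set b | ip_feasible A b !=set0 /\ has_lbound (ip_values c A b)]].

Definition generic (R : realType) A c : Prop :=
  forall b, 0 < b -> exists! x : 'cV[R]_n, lp_optimal c A b x.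

(* The index tau(A, c), as a relation: for a generic (A, c) the optimal solution
   below is the only one, so at most one index is related to (A, c). *)
Definition is_tau (R : realType) A c (tau : 'I_n) : Prop :=
  forall b, 0 < b ->
    exists2 x : 'cV[R]_n, lp_optimal c A b x &
      forall j, (x j 0 != 0) = (j == tau).

(* col' tau deletes the entry of index tau. *)
Definition lvec A c (tau : 'I_n) : 'rV[rat]_n.-1 :=
  col' tau c - (c 0 tau * ((A 0 tau)%:~R)^-1) *: map_mx intr (col' tau A).

Definition pos_coprime A : Prop :=
  (forall i, 0 < A 0 i) /\ \big[gcdn/0%N]_(i < n) absz (A 0 i) = 1%N.

End IntegerProgramming.

Section Covering.
Context (R : realType) (d : nat).

Definition std_simplex : set 'rV[R]_d :=
  [set x | (forall i, 0 <= x 0 i) /\ \sum_(i < d) x 0 i <= 1].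

(* The lattice whose basis consists of the rows of B. *)
Definition lattice_of (B : 'M[R]_d) : set 'rV[R]_d :=
  [set map_mx intr z *m B | z in [set: 'rV[int]_d]].

Definition lattice_of_det (D : R) (L : set 'rV[R]_d) : Prop :=
  exists B : 'M[R]_d, [/\ B \in unitmx, `|\det B| = D & L = lattice_of B].

Definition covering_radius (K L : set 'rV[R]_d) : R :=
  minimum [set mu : R | 0 < mu /\ [set mu *: x + y | x in K & y in L] = setT].

Definition rho : R :=
  inf [set covering_radius std_simplex L | L in lattice_of_det 1].

End Covering.

Definition l1norm (R : realType) (m : nat) (v : 'rV[rat]_m) : R :=
  \sum_(j < m) `|ratr (v 0 j)|.

Definition geo_term (R : realType) (n : nat) (A : 'rV[int]_n) (c : 'rV[rat]_n)
    (tau : 'I_n) : R :=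
  (`|(A 0 tau)%:~R| * \prod_(j < n.-1) ratr (lvec A c tau 0 j))
    `^ ((n.-1)%:R^-1).

(* Main.v *)
Require Import Defs.
From mathcomp Require Import boolp topology normedtype sequences zify ring lra.

(* Eliminating x_tau, an integer solution x of A x = b has gap l . y, where y is x
   without its entry tau, and y runs over nonnegative points of a fixed class modulo
   the lattice Lambda of the v with A_taubar . v = 0 mod a_tau.  Rounding real points
   down to integer points turns bounds on l . y over all classes into coverings of
   R^(n-1) by {x >= 0 : l . x <= Gap + |l|_1} + Lambda, that is, after scaling by
   diag(l), into coverings by a simplex and a lattice of determinant a_tau l_1...l_(n-1).
   This gives (i).

   For (ii) take c = (0, 1, ..., 1), so that l = (1, ..., 1).  A nearly optimal lattice
   is approximated by M / N with M an integer matrix, and M = L D U (Smith form) is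
   replaced by L (t D + E) U with t large and E the superdiagonal of ones: modulo the
   rows of t D + E each e_(i+1) is a multiple of e_i, so this lattice has the form
   {v : r . v = 0 mod q} with gcd(r) = 1.  Setting a_tau = q and adding the same large
   multiple of q to all r_j mod q makes the knapsack constraint harmless, because a
   smaller |y|_1 then forces a smaller A_taubar . y; hence Gap is the one of the group
   problem. *)

Set Implicit Arguments.
Unset Strict Implicit.
Unset Printing Implicit Defensive.

Import Order.TTheory GRing.Theory Num.Theory.
Import numFieldNormedType.Exports.
Local Open Scope ring_scope.

(** * Least elements and minimisation over finite sets *)

Lemma minimumE (T : numDomainType) (S : set T) (m : T) :
  S m -> lbound S m -> minimum S = m.
Proof.
move=> Sm lbm; apply: xget_unique; first by split.
move=> y [Sy lby]; apply/eqP; rewrite eq_le.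
by rewrite lby // lbm.
Qed.

Lemma maximumE (T : numDomainType) (S : set T) (m : T) :
  S m -> ubound S m -> maximum S = m.
Proof.
move=> Sm ubm; apply: xget_unique; first by split.
move=> y [Sy uby]; apply/eqP; rewrite eq_le.
by rewrite uby // ubm.
Qed.

Lemma bounded_int_mx_seq (m n N : nat) :
  exists s : seq 'M[int]_(m, n), forall z : 'M[int]_(m, n),
    (forall i j, `|z i j| <= N%:Z) -> z \in s.
Proof.
exists [seq \matrix_(i, j) ((f (i, j) : nat)%:Z - N%:Z)
   | f : {ffun 'I_m * 'I_n -> 'I_(N + N).+1}] => z zN.
apply/mapP; exists [ffun p => inord (absz (z p.1 p.2 + N%:Z))].
  by rewrite mem_enum.
apply/matrixP => i j; rewrite !mxE ffunE /= inordK.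
  by have := zN i j; lia.
by have := zN i j; lia.
Qed.

(** [P] is an arbitrary proposition, so [s] cannot be filtered by it; the induction decides
    classically whether [a], or anything else, satisfies [P]. *)
Lemma ex_argmin_seq (d : Order.disp_t) (V : orderType d) (T : eqType) (s : seq T)
    (P : T -> Prop) (f : T -> V) :
  (exists x, P x) -> (forall x, P x -> x \in s) ->
  exists2 x, P x & forall y, P y -> (f x <= f y)%O.
Proof.
elim: s P => [|a s IHs] P [x Px] Ps; first by have := Ps _ Px.
have [[y [Py ya]]|nPa] := pselect (exists y, P y /\ y != a); last first.
  exists x => // y Py.
  have eqa z : P z -> z = a.
    by move=> Pz; apply: contra_notP nPa => /eqP za; exists z.
  by rewrite (eqa _ Px) (eqa _ Py).
have [|z|z [Pz za] zmin] := IHs (fun z => P z /\ z != a); first by exists y.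
  by case=> /Ps; rewrite inE => /predU1P[->|//]; rewrite eqxx.
have [Pa|nPa] := pselect (P a); last first.
  exists z => // t Pt; apply: zmin; split=> //.
  by apply: contra_notN nPa => /eqP <-.
have [le_za|lt_az] := leP (f z) (f a).
  by exists z => // t Pt; have [->//|ta] := eqVneq t a; apply: zmin.
exists a => // t Pt; have [->//|ta] := eqVneq t a.
by rewrite (le_trans (ltW lt_az)) // zmin.
Qed.

(** * Coverings by a simplex and a lattice *)

Section Covers.
Context (R : realType) (d : nat).
Implicit Types (B : 'M[R]_d) (x y : 'rV[R]_d) (z : 'rV[int]_d) (mu : R).

(** For mu > 0 this is mu Delta + Lambda = R^d, phrased through the remainder x - z B, which is
    easier to estimate than a scaled point of Delta. *)
Definition covers B mu : Prop := forall x, exists z : 'rV[int]_d,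
  (forall i, 0 <= (x - map_mx intr z *m B) 0 i) /\
  \sum_i (x - map_mx intr z *m B) 0 i <= mu.

Lemma covers_simplex B mu (mu0 : 0 < mu) :
  [set mu *: x + y | x in std_simplex (R:=R) (d:=d) & y in lattice_of B]%classic
    = setT <-> covers B mu.
Proof.
split=> [cov x|cov].
  have : setT x by [].
  rewrite -cov => -[s [s0 s1]] [_ [z _ <-] <-]; exists z.
  rewrite addrK; split=> [i|]; first by rewrite mxE mulr_ge0 // ltW.
  under eq_bigr do rewrite mxE.
  by rewrite -mulr_sumr -[leRHS]mulr1 ler_wpM2l // ltW.
apply/seteqP; split=> // x _; have [z [z0 z1]] := cov x.
exists (mu^-1 *: (x - map_mx intr z *m B)).
  split=> [i|]; first by rewrite mxE mulr_ge0 // invr_ge0 ltW.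
  under eq_bigr do rewrite mxE.
  by rewrite -mulr_sumr mulrC ler_pdivrMr // mul1r.
exists (map_mx intr z *m B); first by exists z.
by rewrite scalerA divff ?gt_eqF // scale1r subrK.
Qed.

Lemma covers_le B mu nu : mu <= nu -> covers B mu -> covers B nu.
Proof.
move=> le_mu cov x; have [z [z0 z1]] := cov x.
by exists z; split=> //; apply: le_trans le_mu.
Qed.

(** Rounding down the coordinates with respect to [B] leaves an error with entries at most [C] in
    absolute value; shifting by [C] beforehand makes the remainder nonnegative with entries at most
    2 C. *)
Lemma ex_covers B : B \in unitmx -> exists2 mu, 0 < mu & covers B mu.
Proof.
move=> uB; pose C := 1 + \sum_i \sum_j `|B i j|.
have C0 : 0 < C.
  by rewrite ltr_pwDl // sumr_ge0 // => i _; rewrite sumr_ge0.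
have fB (f : 'rV[R]_d) j : (forall i, `|f 0 i| <= 1) -> `|(f *m B) 0 j| <= C.
  move=> f1; rewrite mxE (le_trans (ler_norm_sum _ _ _)) // /C.
  rewrite -[leLHS]add0r lerD ?ler01 // ler_sum // => i _.
  rewrite (bigD1 j) //= normrM -[leLHS]addr0 lerD ?sumr_ge0 //.
  by rewrite ler_piMl.
exists (1 + C *+ 2 *+ d) => [|x].
  by rewrite ltr_pwDl // mulrn_wge0 // mulrn_wge0 // ltW.
pose w := (x - const_mx C) *m invmx B.
exists (\row_i Num.floor (w 0 i)).
set z := map_mx _ _.
have -> : x - z *m B = const_mx C + (w - z) *m B.
  by rewrite mulmxBl /w mulmxKV // addrA [const_mx _ + _]addrC subrK.
have f1 i : `|(w - z) 0 i| <= 1.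
  have := floor_itv (w 0 i); rewrite !mxE intrD => /andP[h1 h2].
  by rewrite ger0_norm ?subr_ge0 // lerBlDl ltW.
split=> [i|].
  by rewrite mxE [const_mx _ _ _]mxE; have := fB _ i f1; rewrite ler_norml; lra.
apply: (@le_trans _ _ (\sum_(i < d) (C *+ 2))).
  apply: ler_sum => i _.
  by rewrite mxE [const_mx _ _ _]mxE; have := fB _ i f1; rewrite ler_norml; lra.
by rewrite sumr_const card_ord lerDr.
Qed.

(** For fixed x only finitely many z leave a remainder in (m + 1) Delta, so the smallest coordinate
    sum is attained; as it is at most every mu > m, it is at most m. *)
Lemma covers_closed B m : B \in unitmx ->
  (forall mu, m < mu -> covers B mu) -> covers B m.
Proof.
move=> uB cov x.
pose v z := x - map_mx intr z *m B.
pose C := \sum_i \sum_j (`|x 0 i| + `|m + 1|) * `|invmx B i j|.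
have [s sP] := bounded_int_mx_seq 1 d `|Num.ceil C|.
pose P z := (forall i, 0 <= v z 0 i) /\ \sum_i v z 0 i <= m + 1.
have Ps z : P z -> z \in s.
  move=> [v0 v1]; apply: sP => i j; rewrite (ord1 i) {i}.
  rewrite -(ler_int R).
  suff zC : `|z 0 j|%:~R <= C 
    by apply: le_trans zC _; rewrite (le_trans (ceil_ge _)) // ler_int lez_abs.
  have -> : `|z 0 j|%:~R = `|((x - v z) *m invmx B) 0 j|.
    by rewrite /v opprB addrC subrK mulmxK // mxE intr_norm.
  rewrite mxE (le_trans (ler_norm_sum _ _ _)) // ler_sum // => i _.
  have vi : `|v z 0 i| <= `|m + 1|.
    rewrite ger0_norm // (le_trans _ (ler_norm _)) // (le_trans _ v1) //.
    by rewrite (bigD1 i) //= lerDl sumr_ge0.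
  rewrite (bigD1 j) //= normrM -[leLHS]addr0 lerD ?sumr_ge0 //; last first.
    by move=> k _; rewrite mulr_ge0 // addr_ge0.
  rewrite ler_wpM2r // 2!mxE (le_trans (ler_normB _ _)) // lerD //.
have exP : exists z, P z.
  by have [|z zP] := cov (m + 1) _ x; [rewrite ltrDl | exists z].
have [z [z0 z1] zmin] := ex_argmin_seq (fun z => \sum_i v z 0 i) exP Ps.
exists z; split=> //; apply/ler_addgt0Pr => e e0.
(* Capping e at 1 keeps t among the candidates described by [P]. *)
have [|t [t0 t1]] := cov (m + Num.min e 1) _ x.
  by rewrite ltrDl lt_min e0 ltr01.
apply: (@le_trans _ _ (m + Num.min e 1)); last by rewrite lerD2l ge_min lexx.
apply: (le_trans _ t1); apply: zmin; split=> //; apply: (le_trans t1).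
by rewrite lerD2l ge_min lexx orbT.
Qed.

(** At mu = 0 every point would be a lattice point, which half a basis vector is not. *)
Lemma not_covers0 B : (0 < d)%N -> B \in unitmx -> ~ covers B 0.
Proof.
move=> d0 uB cov; pose i0 : 'I_d := Ordinal d0.
have [z [z0 z1]] := cov (2^-1 *: (delta_mx 0 i0 *m B)).
have : 2^-1 *: (delta_mx 0 i0 *m B) - map_mx intr z *m B = 0.
  apply/rowP => i; rewrite [RHS]mxE; move: z1; set v := _ - _ => z1.
  have : \sum_i v 0 i == 0 by rewrite eq_le z1 sumr_ge0.
  by rewrite psumr_eq0 // => /allP/(_ i); rewrite mem_index_enum => /(_ isT)/eqP.
move/subr0_eq; rewrite scalemxAl => /(congr1 (mulmx^~ (invmx B))).
rewrite !mulmxK // => /rowP/(_ i0); rewrite !mxE !eqxx mulr1.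
move/(congr1 (fun t => t * 2)); rewrite mulVf ?pnatr_eq0 //.
rewrite -(intrM _ _ 2) => /eqP; rewrite -[1]/(1%:~R) eqr_int; lia.
Qed.

(** The infimum of the admissible mu is itself admissible, by [covers_closed] and [not_covers0], so
    [minimum] does not fall back on its default 0. *)
Lemma covering_radiusP B : (0 < d)%N -> B \in unitmx ->
  0 < covering_radius (std_simplex (R:=R) (d:=d)) (lattice_of B) /\
  covers B (covering_radius (std_simplex (R:=R) (d:=d)) (lattice_of B)).
Proof.
move=> d0 uB; rewrite /covering_radius.
set S := (X in minimum X).
have SE mu : S mu <-> 0 < mu /\ covers B mu.
  by split=> -[mu0 /(covers_simplex B mu0)].
have [mu1 mu10 cov1] := ex_covers uB.
have lbS : has_lbound S by exists 0 => mu [/ltW].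
have infS : has_inf S by split=> //; exists mu1; apply/SE.
have cov : covers B (inf S).
  apply: covers_closed => // mu; rewrite -subr_gt0 => /(inf_adherent)/(_ infS)[e Se].
  rewrite addrC subrK => /ltW le_e; apply: covers_le le_e _.
  by case/SE: Se.
have pos : 0 < inf S.
  rewrite lt_neqAle lb_le_inf ?andbT; last by move=> mu [/ltW].
  - by apply: contra_notN (not_covers0 d0 uB) => /eqP ->.
  - by exists mu1; apply/SE.
suff -> : minimum S = inf S by [].
by apply: minimumE; [apply/SE | apply: ge_inf].
Qed.

Lemma covering_radius_ge0 (L : set 'rV[R]_d) :
  0 <= covering_radius (std_simplex (R:=R) (d:=d)) L.
Proof.
rewrite /covering_radius /minimum.
by case: xgetP => [m _ [[/ltW ? _] _]|] .
Qed.

Lemma covering_radius_le B mu : 0 < mu -> covers B mu ->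
  covering_radius (std_simplex (R:=R) (d:=d)) (lattice_of B) <= mu.
Proof.
move=> mu0 cov; rewrite /covering_radius /minimum.
(* Without a least element the value is the default 0, and mu > 0 suffices. *)
case: xgetP => [m _ [_ lbm]|_]; last exact: ltW.
by apply: lbm; split=> //; apply/covers_simplex.
Qed.

(** Write B' = B (1 + F). Covering the preimage of x under 1 + F by B leaves a remainder v (1 + F),
    and the entries of v F are at most mu delta. Shifting x by mu delta first keeps the remainder
    nonnegative; the shift and v F together add at most 2 d mu delta to the sum. *)
Lemma covers_perturb B B' mu (delta : R) : 0 <= mu -> covers B mu ->
  B \in unitmx -> B' \in unitmx ->
  (forall i j, `|(invmx B *m B' - 1%:M) i j| <= delta) ->
  covers B' (mu * (1 + delta *+ d *+ 2)).
Proof.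
move=> mu0 cov uB uB' dB x; set F := (_ - _) in dB.
have GE : invmx B *m B' = 1%:M + F by rewrite /F addrC subrK.
clearbody F.
have uG : invmx B *m B' \in unitmx by rewrite unitmx_mul unitmx_inv uB.
have [z [z0 z1]] := cov ((x - const_mx (mu * delta)) *m invmx (invmx B *m B')).
exists z; set v := (_ - _) in z0 z1.
have -> : x - map_mx intr z *m B' = const_mx (mu * delta) + v + v *m F.
  have -> : const_mx (mu * delta) + v + v *m F =
      const_mx (mu * delta) + v *m (invmx B *m B').
    by rewrite GE mulmxDr mulmx1 -addrA.
  rewrite /v mulmxBl mulmxKV // addrA [const_mx _ + _]addrC subrK.
  by rewrite -mulmxA (mulmxA B) mulmxV // mul1mx.
have vF i : `|(v *m F) 0 i| <= mu * delta.
  rewrite mxE (le_trans (ler_norm_sum _ _ _)) //.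
  apply: (@le_trans _ _ (\sum_j v 0 j * delta)).
    by apply: ler_sum => j _; rewrite normrM ger0_norm // ler_wpM2l.
  rewrite -mulr_suml ler_wpM2r //.
  by apply: le_trans (dB i i); apply: normr_ge0.
split=> [i|].
  rewrite mxE [(_ + v) 0 i]mxE [const_mx _ _ _]mxE.
  by have := vF i; have := z0 i; rewrite ler_norml; lra.
apply: (@le_trans _ _ (\sum_i (v 0 i + (mu * delta) *+ 2))).
  apply: ler_sum => i _; rewrite mxE [(_ + v) 0 i]mxE [const_mx _ _ _]mxE.
  by have := vF i; rewrite ler_norml; lra.
rewrite big_split /= sumr_const card_ord.
by rewrite mulrDr mulr1 lerD // !mulrnAr -!mulrnA mulnC lexx.
Qed.

End Covers.

(** * Integrality gaps of knapsack problems *)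

Section Knapsack.
Context (R : realType) (d : nat) (A : 'rV[int]_d.+1) (c : 'rV[rat]_d.+1).
Context (tau : 'I_d.+1).
Context (A_gt0 : forall i, 0 < A 0 i).

Definition redcost (j : 'I_d) : R := ratr (lvec A c tau 0 j).

(** The linear form l . y, which by [IG_opt] is the integrality gap at an optimal solution. *)
Definition weight (y : 'cV[int]_d) : R := \sum_j redcost j * (y j 0)%:~R.

Local Notation at_ := ((A 0 tau)%:~R : R).
Local Notation a_ j := ((A 0 (lift tau j))%:~R : R).

Let Ai_gt0 i : 0 < (A 0 i)%:~R :> R. Proof. by rewrite ltr0z. Qed.

Let at_neq0 : at_ != 0. Proof. by rewrite gt_eqF. Qed.

Lemma redcostE j :
  redcost j = ratr (c 0 (lift tau j)) - ratr (c 0 tau) / at_ * a_ j.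
Proof.
by rewrite /redcost /lvec !mxE rmorphB /= !rmorphM /= fmorphV /= !ratr_int.
Qed.

Lemma lp_feasibleE b (x : 'cV[R]_d.+1) : lp_feasible A b x <->
  at_ * x tau 0 + \sum_j a_ j * x (lift tau j) 0 = b%:~R /\
  forall i, 0 <= x i 0.
Proof.
have E : (map_mx intr A *m x) 0 0 = at_ * x tau 0 + \sum_j a_ j * x (lift tau j) 0.
  rewrite mxE (bigD1_ord tau) //= mxE; congr (_ + _).
  by apply: eq_bigr => j _; rewrite mxE.
split=> -[e x0]; split=> //; first by rewrite -E e mxE eqxx.
by apply/matrixP => i j; rewrite !ord1 E e mxE eqxx.
Qed.

Lemma ip_feasibleE b (x : 'cV[int]_d.+1) : ip_feasible A b x <->
  A 0 tau * x tau 0 + \sum_j A 0 (lift tau j) * x (lift tau j) 0 = b /\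
  forall i, 0 <= x i 0.
Proof.
have E : (A *m x) 0 0 = A 0 tau * x tau 0 + \sum_j A 0 (lift tau j) * x (lift tau j) 0.
  by rewrite mxE (bigD1_ord tau).
split=> -[e x0]; split=> //; first by rewrite -E e mxE eqxx.
by apply/matrixP => i j; rewrite !ord1 E e mxE eqxx.
Qed.

Lemma ip_lp_feasible b (x : 'cV[int]_d.+1) :
  ip_feasible A b x -> lp_feasible A b (map_mx intr x : 'cV[R]_d.+1).
Proof.
move=> [e x0]; split=> [|i]; last by rewrite mxE ler0z.
by rewrite -map_mxM e map_scalar_mx.
Qed.

(** Substituting x_tau from A x = b splits the cost into a constant depending only on b and the
    reduced costs of the other entries. *)
Lemma lp_objectiveE b (x : 'cV[R]_d.+1) : lp_feasible A b x ->
  lp_objective c x =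
  ratr (c 0 tau) / at_ * b%:~R + \sum_j redcost j * x (lift tau j) 0.
Proof.
move=> /lp_feasibleE[<- _].
rewrite /lp_objective mxE (bigD1_ord tau) //= mxE mulrDr.
rewrite mulrA divfK // -addrA; congr (_ + _); rewrite mulr_sumr -big_split /=.
by apply: eq_bigr => j _; rewrite mxE redcostE; ring.
Qed.

Lemma lp_objective_int (x : 'cV[int]_d.+1) :
  lp_objective c (map_mx intr x : 'cV[R]_d.+1) = ratr ((c *m map_mx intr x) 0 0).
Proof.
rewrite /lp_objective !mxE rmorph_sum; apply: eq_bigr => i _ /=.
by rewrite !mxE rmorphM /= ratr_int.
Qed.

Definition lp_basic b : 'cV[R]_d.+1 :=
  \col_i (if i == tau then b%:~R / at_ else 0).

Let lp_basic_lift b j : lp_basic b (lift tau j) 0 = 0.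
Proof. by rewrite mxE eq_sym (negPf (neq_lift _ _)). Qed.

Lemma lp_basic_feasible b : 0 <= b -> lp_feasible A b (lp_basic b).
Proof.
move=> b0; apply/lp_feasibleE; split.
  rewrite big1 => [|j _]; last by rewrite lp_basic_lift mulr0.
  by rewrite mxE eqxx addr0 mulrC divfK.
move=> i; rewrite mxE; case: ifP => // _.
by rewrite divr_ge0 ?ler0z // ltW.
Qed.

Lemma lp_basic_objective b : 0 <= b ->
  lp_objective c (lp_basic b) = ratr (c 0 tau) / at_ * b%:~R.
Proof.
move=> /lp_basic_feasible/lp_objectiveE ->.
by rewrite big1 ?addr0 // => j _; rewrite lp_basic_lift mulr0.
Qed.

(** At b = 1, compare the optimal solution, supported on tau, with the vertex supported on
    [lift tau j]: the costs differ by l_j / a_j, which is nonnegative by optimality and nonzero by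
    uniqueness. *)
Lemma redcost_gt0 : generic R A c -> is_tau R A c tau -> forall j, 0 < redcost j.
Proof.
move=> gen tauP j.
have [x [xf xmin] xtau] := tauP 1 ltr01.
pose y : 'cV[R]_d.+1 := \col_i (if i == lift tau j then (a_ j)^-1 else 0).
have ylift k : y (lift tau k) 0 = if k == j then (a_ j)^-1 else 0.
  by rewrite mxE (inj_eq (@lift_inj _ _)).
have yf : lp_feasible A 1 y.
  apply/lp_feasibleE; split.
    rewrite mxE (negPf (neq_lift _ _)) mulr0 add0r (bigD1 j) //= ylift eqxx.
    rewrite mulfV ?gt_eqF // big1 ?addr0 // => k /negPf kj.
    by rewrite ylift kj mulr0.
  by move=> i; rewrite mxE; case: ifP => // _; rewrite invr_ge0 ltW.
have oy : lp_objective c y = lp_objective c x + redcost j / a_ j.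
  rewrite (lp_objectiveE yf) (lp_objectiveE xf) [in RHS]big1 => [|k _].
    rewrite addr0 (bigD1 j) //= ylift eqxx big1 ?addr0 // => k /negPf kj.
    by rewrite ylift kj mulr0.
  suff -> : x (lift tau k) 0 = 0 by rewrite mulr0.
  by apply/eqP/negPn; rewrite xtau eq_sym neq_lift.
have l_ge0 : 0 <= redcost j.
  by have := xmin _ yf; rewrite oy lerDl pmulr_lge0 // invr_gt0.
rewrite lt_neqAle l_ge0 andbT; apply/eqP => l0.
have [x' [_ uniq]] := gen 1 ltr01.
have xx' : x' = x by apply: uniq.
have xy : x' = y.
  by apply: uniq; split=> // z zf; rewrite oy -l0 mul0r addr0 xmin.
have := xtau (lift tau j); rewrite -xx' xy ylift eqxx invr_eq0 gt_eqF //=.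
by rewrite eq_sym (negPf (neq_lift _ _)).
Qed.

Context (l_gt0 : forall j, 0 < redcost j).

Lemma lp_basic_min b (y : 'cV[R]_d.+1) : 0 <= b -> lp_feasible A b y ->
  lp_objective c (lp_basic b) <= lp_objective c y.
Proof.
move=> b0 yf; rewrite lp_basic_objective // (lp_objectiveE yf) lerDl sumr_ge0 // => j _.
by case: yf => _ y0; rewrite mulr_ge0 // ltW.
Qed.

Lemma LPE b : 0 <= b -> LP R c A b = ratr (c 0 tau) / at_ * b%:~R.
Proof.
move=> b0; rewrite -lp_basic_objective //; apply: minimumE.
  by exists (lp_basic b) => //; apply: lp_basic_feasible.
by move=> _ [y yf <-]; apply: lp_basic_min.
Qed.

(** Positive reduced costs penalise every nonzero entry outside tau, so [lp_basic] is the only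
    optimum. This is how the examples of (ii) are seen to be generic. *)
Lemma generic_redcost : generic R A c.
Proof.
move=> b b0; exists (lp_basic b); split.
  split; first exact/lp_basic_feasible/ltW.
  by move=> y; apply: lp_basic_min; apply: ltW.
move=> y [yf /(_ _ (lp_basic_feasible (ltW b0)))].
rewrite (lp_basic_objective (ltW b0)) (lp_objectiveE yf) gerDl => le0.
have y_ge0 i : 0 <= y i 0 by case: yf.
have : \sum_j redcost j * y (lift tau j) 0 == 0.
  by rewrite eq_le le0 sumr_ge0 // => j _; rewrite mulr_ge0 // ltW.
rewrite psumr_eq0 => [/allP y0|j _]; last by rewrite mulr_ge0 // ltW.
have {}y0 j : y (lift tau j) 0 = 0.
  have := y0 j; rewrite mem_index_enum => /(_ isT).
  by rewrite mulf_eq0 gt_eqF // => /eqP.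
have [] := (lp_feasibleE b y).1 yf.
rewrite big1 => [|j _]; last by rewrite y0 mulr0.
rewrite addr0 => yt _; apply/matrixP => i k; rewrite ord1.
case: (unliftP tau i) => [j ->|->]; first by rewrite lp_basic_lift y0.
by rewrite mxE eqxx -yt mulrC mulKf.
Qed.

Lemma is_tau_redcost : is_tau R A c tau.
Proof.
move=> b b0; exists (lp_basic b).
  split; first exact/lp_basic_feasible/ltW.
  by move=> y; apply: lp_basic_min; apply: ltW.
move=> j; rewrite mxE; case: ifP => _; last by rewrite eqxx.
by rewrite mulf_neq0 ?invr_eq0 // intr_eq0 gt_eqF.
Qed.

Lemma ip_feasible_ge0 b (x : 'cV[int]_d.+1) : ip_feasible A b x -> 0 <= b.
Proof.
move=> /ip_feasibleE[<- x0]; rewrite addr_ge0 //.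
  by rewrite mulr_ge0 // ltW.
by rewrite sumr_ge0 // => j _; rewrite mulr_ge0 // ltW.
Qed.

(** As A is positive, A x = b has finitely many nonnegative integer solutions, so the optimum is
    attained. Subtracting the LP value removes the constant and leaves the weight. *)
Lemma IG_opt b : (exists x, ip_feasible A b x) ->
  exists x : 'cV[int]_d.+1, [/\ ip_feasible A b x,
    IG R c A b = weight (row' tau x) &
    forall y, ip_feasible A b y -> weight (row' tau x) <= weight (row' tau y)].
Proof.
move=> exf.
have [s sP] := bounded_int_mx_seq d.+1 1 `|b|.
have fs x : ip_feasible A b x -> x \in s.
  move=> [e x0]; apply: sP => i j; rewrite (ord1 j) ger0_norm //.
  apply: (@le_trans _ _ b); last by rewrite lez_abs.
  have -> : b = (A *m x) 0 0 by rewrite e mxE eqxx.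
  rewrite mxE (bigD1 i) //= -[leLHS]addr0 lerD //; last first.
    by rewrite sumr_ge0 // => k _; rewrite mulr_ge0 // ltW.
  by rewrite ler_peMl // -gtz0_ge1.
have [x xf xmin] := ex_argmin_seq (fun x => (c *m map_mx intr x) 0 0) exf fs.
have b0 := ip_feasible_ge0 xf.
have ipE : IP c A b = (c *m map_mx intr x) 0 0.
  by apply: minimumE; [exists x | move=> _ [y yf <-]; apply: xmin].
have objE y : ip_feasible A b y -> ratr ((c *m map_mx intr y) 0 0) =
    ratr (c 0 tau) / at_ * b%:~R + weight (row' tau y).
  move=> /ip_lp_feasible yf; rewrite -lp_objective_int (lp_objectiveE yf).
  by congr (_ + _); apply: eq_bigr => j _; rewrite !mxE.
exists x; split=> //.
  by rewrite /IG ipE LPE // objE // addrC addKr.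
move=> y yf; rewrite -(lerD2l (ratr (c 0 tau) / at_ * b%:~R)).
by rewrite -!objE // ler_rat xmin.
Qed.

(* If an optimal solution had x_j >= a_tau, trading a_tau units of j for a_j units
   of tau would be feasible and strictly cheaper. *)
Lemma opt_lt b (x : 'cV[int]_d.+1) : ip_feasible A b x ->
  (forall y, ip_feasible A b y -> weight (row' tau x) <= weight (row' tau y)) ->
  forall j, x (lift tau j) 0 < A 0 tau.
Proof.
move=> /ip_feasibleE[xb x0] xmin j; rewrite ltNge; apply/negP => le_x.
pose y : 'cV[int]_d.+1 := \col_i (x i 0 +
  (if i == tau then A 0 (lift tau j) else if i == lift tau j then - A 0 tau else 0)).
have yt : y tau 0 = x tau 0 + A 0 (lift tau j) by rewrite mxE eqxx.
have yl k : y (lift tau k) 0 = x (lift tau k) 0 - (if k == j then A 0 tau else 0).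
  rewrite mxE eq_sym (negPf (neq_lift _ _)) (inj_eq (@lift_inj _ _)).
  by case: eqP; rewrite ?subr0 ?addr0.
have /xmin : ip_feasible A b y.
  apply/ip_feasibleE; split.
    rewrite -xb yt (bigD1 j) //= yl eqxx [in RHS](bigD1 j) //=.
    rewrite (eq_bigr (fun k => A 0 (lift tau k) * x (lift tau k) 0)); first by ring.
    by move=> k /negPf kj; rewrite yl kj subr0.
  move=> i; case: (unliftP tau i) => [k ->|->]; last first.
    by rewrite yt addr_ge0 // ltW.
  by rewrite yl; case: eqP => [->|_]; rewrite ?subr0 // subr_ge0.
rewrite leNgt => /negP; apply.
have ry k : row' tau y k 0 = row' tau x k 0 - (if k == j then A 0 tau else 0).
  by rewrite mxE yl [in RHS]mxE.
rewrite /weight [ltLHS](bigD1 j) //= [ltRHS](bigD1 j) //= ry eqxx.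
rewrite (eq_bigr (fun k => redcost k * (row' tau x k 0)%:~R)).
  by rewrite ltrD2r ltr_pM2l // ltr_int ltrBlDr ltrDl.
by move=> k /negPf kj; rewrite ry kj subr0.
Qed.

Lemma weight_ge0 (y : 'cV[int]_d) : (forall j, 0 <= y j 0) -> 0 <= weight y.
Proof. by move=> y0; rewrite sumr_ge0 // => j _; rewrite mulr_ge0 ?ler0z // ltW. Qed.

(** By [opt_lt] all gaps are weights of vectors with entries in [0, a_tau). There are finitely many
    of these, so the maximum over b is attained. *)
Lemma GapP :
  (exists b x, ip_feasible A b x /\ IG R c A b = Gap R c A) /\
  forall b x, ip_feasible A b x -> IG R c A b <= Gap R c A.
Proof.
have [s sP] := bounded_int_mx_seq d 1 `|A 0 tau|.
pose P v := exists b, (exists x, ip_feasible A b x) /\ IG R c A b = v.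
have exP : exists v, P v.
  exists (IG R c A 0); exists 0; split=> //; exists 0.
  by split=> [|i]; rewrite ?mulmx0 ?mxE ?raddf0.
have Ps v : P v -> v \in map weight s.
  move=> [b [/IG_opt[x [xf -> xmin]] <-]]; apply: map_f; apply: sP => i j.
  rewrite (ord1 j) mxE ger0_norm; last by case: xf.
  by apply/ltW/(lt_le_trans (opt_lt xf xmin i)); rewrite lez_abs.
have [v [b [exf bv]] vmax] := ex_argmin_seq (V := R) (fun v => - v) exP Ps.
(* A feasible b also has integer values bounded below, so it is in the range over which [Gap]
   maximises. *)
have IGset b' x : ip_feasible A b' x ->
    [set b | (ip_feasible A b !=set0)%classic /\ has_lbound (ip_values c A b)]%classic b'.
  move=> xf; split; first by exists x.
  exists (IP c A b') => _ [y yf <-].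
  have /IG_opt[z [zf zIG zmin]] : exists x, ip_feasible A b' x by exists x.
  rewrite -(ler_rat R) -lp_objective_int (lp_objectiveE (ip_lp_feasible yf)).
  move: zIG; rewrite /IG LPE ?(ip_feasible_ge0 xf) // => /(canRL (subrK _)) ->.
  rewrite addrC lerD2l (le_trans (zmin _ yf)) //.
  by rewrite le_eqVlt; apply/orP; left; apply/eqP/eq_bigr => k _; rewrite !mxE.
have Gapv : Gap R c A = v.
  apply: maximumE; first by case: exf => x xf; exists b => //; apply: IGset xf.
  move=> _ [b' [[x xf] _] <-]; rewrite -lerN2; apply: vmax.
  by exists b'; split=> //; exists x.
split; first by case: exf => x xf; exists b, x; rewrite Gapv.
move=> b' x xf; rewrite Gapv -lerN2; apply: vmax.
by exists b'; split=> //; exists x.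
Qed.

End Knapsack.

(** * The lower bound *)

Lemma normr_unitz (u : int) : u \is a GRing.unit -> `|u| = 1.
Proof. by rewrite unfold_in /= => /orP[]/eqP->. Qed.

(** The Smith form turns w into g e_0 with gcd(q, g) = 1, so v . w = 0 mod q constrains only
    coordinate 0 of v L, and the rows of diag(q, 1, ..., 1) L^-1 form a basis. *)
Lemma congruence_lattice_basis (d : nat) (q : int) (w : 'cV[int]_d.+1) : 0 < q ->
  (forall k : int, (k %| q)%Z -> (forall j, k %| (w j 0)%R)%Z -> (k %| 1)%Z) ->
  exists2 M : 'M[int]_d.+1, `|\det M| = q &
    forall v : 'rV[int]_d.+1, (q %| ((v *m w) 0 0)%R)%Z -> exists z, v = z *m M.
Proof.
move=> q0 cop; have [L uL [U uU [s _ wE]]] := int_Smith_normal_form w.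
pose g := s`_0 * U 0 0.
have LwE i : (invmx L *m w) i 0 = g *+ (i == 0).
  rewrite wE -mulmxA mulKmx // mxE big_ord1 !mxE /g.
  by case: (unliftP ord0 i) => [j ->|->]; rewrite /= ?mulr1n ?mul0r.
have cqg : coprimez q g.
  suff : (gcdz q g %| 1)%Z by rewrite dvdz1 /coprimez /gcdz.
  apply: cop; rewrite ?dvdz_gcdl // => j.
  have -> : w = L *m (invmx L *m w) by rewrite mulKVmx.
  rewrite mxE; apply: rpred_sum => i _; rewrite LwE.
  by case: (i == 0); rewrite ?mulr0 ?dvdz0 // dvdz_mull // dvdz_gcdr.
pose D : 'rV[int]_d.+1 := \row_i (if i == 0 then q else 1).
exists (diag_mx D *m invmx L) => [|v].
  rewrite det_mulmx det_inv normrM (@normr_unitz (\det L)^-1) ?unitrV // mulr1 det_diag.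
  rewrite big_ord_recl big1 => [|i _]; last by rewrite mxE.
  by rewrite mxE eqxx mulr1 gtr0_norm.
have -> : (v *m w) 0 0 = (v *m L) 0 0 * g.
  rewrite -{1}(mulKVmx uL w) (mulmxA v) mxE (bigD1 0) //= LwE eqxx mulr1n.
  rewrite big1 ?addr0 // => i /negPf i0.
  by rewrite LwE i0 mulr0.
rewrite Gauss_dvdzl // => /dvdzP[k kE].
exists (\row_i (if i == 0 then k else (v *m L) 0 i)).
rewrite mulmxA -[LHS](mulmxK uL); congr (_ *m _); apply/rowP => i.
rewrite mul_mx_diag [RHS]mxE mxE [D _ _]mxE; case: ifP => [/eqP ->|_]; last by rewrite mulr1.
by rewrite kE.
Qed.

(** Apply the hypothesis to the floor of the point rescaled by g / l_i; the fractional parts stay in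
    the remainder and cost at most the sum of the l_i. *)
Lemma covers_of_group (R : realType) (d : nat) (l : 'I_d -> R) (M : 'M[int]_d)
    (G g : R) : 0 < g -> (forall i, 0 < l i) ->
  (forall r : 'rV[int]_d, exists y z : 'rV[int]_d,
     [/\ forall i, 0 <= y 0 i, \sum_i l i * (y 0 i)%:~R <= G & r - y = z *m M]) ->
  covers (g^-1 *: (map_mx intr M *m diag_mx (\row_i l i)))
    (g^-1 * (G + \sum_i l i)).
Proof.
move=> g0 l0 grp x.
pose x' i := g * x 0 i / l i.
have [y [z [y0 yG ryz]]] := grp (\row_i Num.floor (x' i)).
exists z.
have E i : (x - map_mx intr z *m (g^-1 *: (map_mx intr M *m diag_mx (\row_i l i)))) 0 i
    = g^-1 * (l i * ((y 0 i)%:~R + (x' i - (Num.floor (x' i))%:~R))).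
  rewrite -scalemxAr mulmxA -map_mxM -ryz mul_mx_diag !mxE rmorphB /= /x'; field.
  by rewrite !gt_eqF.
have fr i : 0 <= x' i - (Num.floor (x' i))%:~R <= 1.
  by have := floor_itv (x' i); rewrite intrD subr_ge0 => /andP[-> /ltW]; rewrite lerBlDl.
split=> [i|].
  rewrite E mulr_ge0 ?invr_ge0 ?(ltW g0) // mulr_ge0 ?(ltW (l0 i)) //.
  by rewrite addr_ge0 ?ler0z //; case/andP: (fr i).
under eq_bigr do rewrite E.
rewrite -mulr_sumr ler_pM2l ?invr_gt0 //.
apply: (@le_trans _ _ (\sum_i l i * (y 0 i)%:~R + \sum_i l i)); last by rewrite lerD2r.
rewrite -big_split /= ler_sum // => i _.
rewrite mulrDr lerD2l -[leRHS]mulr1 ler_wpM2l ?(ltW (l0 i)) //.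
by case/andP: (fr i).
Qed.

Lemma rho_has_lbound (R : realType) (d : nat) : has_lbound
  [set covering_radius (@std_simplex R d) L | L in @lattice_of_det R d 1]%classic.
Proof. by exists 0 => _ [L _ <-]; apply: covering_radius_ge0. Qed.

(** The congruence lattice scaled by diag(l) / g has determinant 1 up to sign and covering radius at
    most (Gap + |l|_1) / g, which rho bounds from below. *)
Lemma Gap_ge_rho (R : realType) (d : nat) (A : 'rV[int]_d.+2) (c : 'rV[rat]_d.+2)
    (tau : 'I_d.+2) : pos_coprime A -> generic R A c -> is_tau R A c tau ->
  rho R d.+1 * geo_term R A c tau - l1norm R (lvec A c tau) <= Gap R c A.
Proof.
move=> [A0 Agcd] gen tauP; have l0 := redcost_gt0 A0 gen tauP.
have [[b0 [x0 [x0f Gap0]]] Gapmax] := GapP A0 l0.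
have G0 : 0 <= Gap R c A.
  rewrite -Gap0; have [|x [xf -> _]] := IG_opt A0 l0 (b := b0); first by exists x0.
  by apply: weight_ge0 => // j; rewrite mxE; case: xf.
rewrite lerBlDr.
have -> : l1norm R (lvec A c tau) = \sum_j redcost R A c tau j.
  by apply: eq_bigr => j _; rewrite gtr0_norm //; apply: l0.
set g := geo_term _ _ _ _; set S := \sum_j _.
have S0 : 0 < S.
  rewrite /S (bigD1 ord0) //= ltr_pwDl ?l0 // sumr_ge0 // => j _; exact/ltW/l0.
have P0 : 0 < (A 0 tau)%:~R * \prod_j redcost R A c tau j.
  by rewrite mulr_gt0 ?ltr0z // prodr_gt0 // => j _; apply: l0.
have gE : g = ((A 0 tau)%:~R * \prod_j redcost R A c tau j) `^ (d.+1%:R^-1).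
  by rewrite /g /geo_term gtr0_norm ?ltr0z.
have g0 : 0 < g by rewrite gE powR_gt0.
have gd : g ^+ d.+1 = (A 0 tau)%:~R * \prod_j redcost R A c tau j.
  by rewrite -powR_mulrn ?ltW // gE -powRrM mulVf ?pnatr_eq0 // powRr1 // ltW.
pose w : 'cV[int]_d.+1 := \col_j A 0 (lift tau j).
have [|M detM latM] := congruence_lattice_basis (w := w) (A0 tau).
  move=> k kt kw; suff : (absz k %| 1)%N by [].
  rewrite -Agcd; apply/dvdn_biggcdP => i _.
  by case: (unliftP tau i) => [j ->|->] //; have := kw j; rewrite mxE.
pose B : 'M[R]_d.+1 := g^-1 *: (map_mx intr M *m diag_mx (\row_i redcost R A c tau i)).
have detB : `|\det B| = 1.
  rewrite /B detZ normrM det_mulmx normrM det_map_mx det_diag -intr_norm detM.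
  rewrite (eq_bigr (redcost R A c tau)) => [|j _]; last by rewrite mxE.
  rewrite [X in _ * (_ * X)]gtr0_norm ?prodr_gt0 // -gd gtr0_norm ?exprn_gt0 ?invr_gt0 //.
  by rewrite -exprMn mulVf ?gt_eqF // expr1n.
have covB : covers B (g^-1 * (Gap R c A + S)).
  apply: covers_of_group => // r.
  (* The residues of r are nonnegative, so together with x_tau = 0 they make this b feasible; an
     optimal y for it lies in the class of r. *)
  pose r' : 'cV[int]_d.+1 := \col_j modz (r 0 j) (A 0 tau).
  pose x1 : 'cV[int]_d.+2 := \col_i (if unlift tau i is Some j then r' j 0 else 0).
  have x1t : x1 tau 0 = 0 by rewrite mxE unlift_none.
  have x1l j : x1 (lift tau j) 0 = r' j 0 by rewrite mxE liftK.
  pose b := \sum_j A 0 (lift tau j) * r' j 0.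
  have x1f : ip_feasible A b x1.
    apply/(ip_feasibleE A tau); split.
      by rewrite x1t mulr0 add0r; apply: eq_bigr => j _; rewrite x1l.
    move=> i; case: (unliftP tau i) => [j ->|->]; last by rewrite x1t.
    by rewrite x1l mxE modz_ge0 // gt_eqF.
  have [|x [xf IGx _]] := IG_opt A0 l0 (b := b); first by exists x1.
  pose y := (row' tau x)^T.
  have [|z zE] := latM (r - y).
    have [xb _] := (ip_feasibleE A tau b x).1 xf.
    (* Modulo a_tau both r . w and y . w equal b, as y . w = b - a_tau x_tau. *)
    have -> : ((r - y) *m w) 0 0 =
        (x tau 0 + \sum_j divz (r 0 j) (A 0 tau) * A 0 (lift tau j)) * A 0 tau.
      rewrite mulrDl.
      rewrite (_ : x tau 0 * _ = b - \sum_j A 0 (lift tau j) * x (lift tau j) 0); last first.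
        by rewrite -xb addrK mulrC.
      rewrite mxE mulr_suml /b addrAC -!big_split /= -sumrB; apply: eq_bigr => j _.
      rewrite !mxE [in LHS](divz_eq (r 0 j) (A 0 tau)); ring.
    exact: dvdz_mull.
  exists y, z; split=> // [i|]; first by rewrite !mxE; case: xf.
  apply: le_trans (Gapmax b x xf); rewrite IGx /weight.
  by rewrite le_eqVlt; apply/orP; left; apply/eqP/eq_bigr => j _; rewrite !mxE.
rewrite -ler_pdivlMr // mulrC.
apply: (@le_trans _ _ (covering_radius (@std_simplex R d.+1) (lattice_of B))).
  apply: ge_inf; first exact: rho_has_lbound.
  exists (lattice_of B) => //; exists B; split=> //.
  by rewrite unitmxE unitfE -normr_eq0 detB oner_eq0.
by apply: covering_radius_le => //; rewrite mulr_gt0 ?invr_gt0 // ltr_wpDl.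
Qed.

(** * Approximation by lattices with cyclic quotient *)

(* When det M != 0, Z^d modulo the row lattice of [M] is then cyclic, the class of v
   being v . r modulo det M. *)
Definition cyclic_lattice (d : nat) (M : 'M[int]_d) (r : 'cV[int]_d) : Prop :=
  (exists u : 'rV[int]_d, u *m r = 1%:M) /\
  forall i, (\det M %| ((M *m r) i 0)%R)%Z.

(** The perturbation L E U does not depend on t, hence is negligible against t M for large t. The
    matrix [W] = t D + E is upper bidiagonal, so E leaves the determinant unchanged. *)
Lemma cyclic_perturbation (d : nat) (M : 'M[int]_d.+1) :
  exists N : 'M[int]_d.+1, forall t : int,
    `|\det (t *: M + N)| = `|t ^+ d.+1 * \det M| /\
    exists r, cyclic_lattice (t *: M + N) r.
Proof.
have [L uL [U uU [s _ ME]]] := int_Smith_normal_form M.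
pose E : 'M[int]_d.+1 := \matrix_(i, j) ((j == i.+1 :> nat)%:R).
have detL : `|\det L| = 1 by rewrite normr_unitz // -unitmxE.
have detU : `|\det U| = 1 by rewrite normr_unitz // -unitmxE.
exists (L *m E *m U) => t.
pose W : 'M[int]_d.+1 := \matrix_(i, j) ((t * s`_i) *+ (i == j) + (j == i.+1 :> nat)%:R).
have WE : t *: M + L *m E *m U = L *m W *m U.
  rewrite ME scalemxAl -mulmxDl scalemxAr -mulmxDr; congr (_ *m _ *m _).
  by apply/matrixP => i j; rewrite !mxE mulrnAr.
have detW : \det W = \prod_(i < d.+1) (t * s`_i).
  rewrite -det_tr det_trig.
    by apply: eq_bigr => i _; rewrite !mxE eqxx mulr1n (ltn_eqF (ltnSn _)) addr0.
  apply/is_trig_mxP => i j lt_ij; rewrite !mxE -val_eqE /= gtn_eqF // mulr0n add0r.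
  by rewrite (_ : _ == _ = false) //; apply/negbTE; rewrite neq_ltn ltnS (ltnW lt_ij).
have detM : `|\det M| = `|\prod_(i < d.+1) s`_i|.
  rewrite ME !det_mulmx !normrM detL detU mul1r mulr1.
  rewrite (_ : \matrix_(i, j) _ = diag_mx (\row_i s`_i)); last first.
    by apply/matrixP => i j; rewrite !mxE.
  by rewrite det_diag; congr (`|_|); apply: eq_bigr => i _; rewrite mxE.
have detLWU : `|\det (L *m W *m U)| = `|\det W|.
  by rewrite !det_mulmx !normrM detL detU mul1r mulr1.
rewrite WE detLWU; split.
  by rewrite detW big_split /= prodr_const card_ord !normrM detM.
(* The rows i < d of W r' = 0 read r'_(i+1) = - t s_i r'_i, which fixes r' once r'_0 = 1; row 0 of U
   then serves as u. *)
pose r' : 'cV[int]_d.+1 := \col_i \prod_(0 <= j < i) (- (t * s`_j)).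
exists (invmx U *m r'); split.
  exists (delta_mx 0 0 *m U); rewrite -mulmxA mulKVmx //.
  apply/matrixP => i j; rewrite !ord1 -rowE !mxE big_geq //.
have Wr i : (\det W %| ((W *m r') i 0)%R)%Z.
  have -> : (W *m r') i 0 = t * s`_i * r' i 0 +
      \sum_(j < d.+1) (j == i.+1 :> nat)%:R * r' j 0.
    rewrite mxE (eq_bigr (fun j => (t * s`_i) *+ (i == j) * r' j 0 +
       (j == i.+1 :> nat)%:R * r' j 0)) => [|j _]; last by rewrite mxE mulrDl.
    rewrite big_split /= (bigD1 i) //= eqxx mulr1n [X in _ + X + _]big1 ?addr0 //.
    by move=> j; rewrite eq_sym => /negPf ->; rewrite mul0r.
  have [lt_id|ge_id] := ltnP i d.
    rewrite (bigD1 (Ordinal (n := d.+1) (m := i.+1) lt_id)) //= eqxx mul1r big1 ?addr0.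
      rewrite !mxE /= big_nat_recr //= mulrN mulrC addrN; exact: dvdz0.
    by move=> j; rewrite -val_eqE /= => /negPf ->; rewrite mul0r.
  (* The last row has no superdiagonal term, and its entry is det W up to sign. *)
  rewrite big1 ?addr0 => [|j _]; last first.
    rewrite (_ : _ == _ = false) ?mul0r //; apply/negbTE.
    by rewrite neq_ltn ltnS (leq_trans _ ge_id) // -ltnS.
  have id : i = d :> nat by apply/eqP; rewrite eqn_leq ge_id -ltnS ltn_ord.
  have -> : \det W = \prod_(0 <= i < d.+1) (t * s`_i) by rewrite big_mkord.
  rewrite mxE id big_nat_recr //= mulrC dvdz_mul // !big_mkord prodrN.
  exact: dvdz_mull.
have -> : L *m W *m U *m (invmx U *m r') = L *m (W *m r').
  by rewrite -!mulmxA mulKVmx.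
move=> i; rewrite mxE; apply: rpred_sum => j _.
move: detLWU; rewrite dvdzE -!abszE => -[->].
by rewrite -dvdzE dvdz_mull.
Qed.

Lemma covers_scale (R : realType) (d : nat) (B : 'M[R]_d) (mu a : R) :
  0 < a -> covers B mu -> covers (a *: B) (a * mu).
Proof.
move=> a0 cov x; have [z [z0 z1]] := cov (a^-1 *: x); exists z.
have -> : x - map_mx intr z *m (a *: B) = a *: (a^-1 *: x - map_mx intr z *m B).
  by rewrite scalerBr scalerA divff ?gt_eqF // scale1r scalemxAr.
split=> [i|]; first by rewrite mxE mulr_ge0 // ltW.
under eq_bigr do rewrite mxE.
by rewrite -mulr_sumr ler_pM2l.
Qed.

Lemma cvg_det (R : realType) (d : nat) (B : 'M[R]_d) (Bn : nat -> 'M[R]_d) :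
  (forall i j, (Bn n i j @[n --> \oo] --> B i j)%classic) ->
  (\det (Bn n) @[n --> \oo] --> \det B)%classic.
Proof.
move=> cvgB; rewrite /determinant.
apply: cvg_big => [|s _]; first exact: add_continuous.
apply: cvgM; first exact: cvg_cst.
by apply: cvg_big => [|i _]; [exact: mul_continuous | exact: cvgB].
Qed.

Lemma floor_approx (R : realType) (x : R) (n : nat) :
  `|n.+1%:R^-1 * (Num.floor (n.+1%:R * x))%:~R - x| <= n.+1%:R^-1.
Proof.
have n0 : 0 < n.+1%:R :> R by rewrite ltr0n.
have -> : n.+1%:R^-1 * (Num.floor (n.+1%:R * x))%:~R - x =
   n.+1%:R^-1 * ((Num.floor (n.+1%:R * x))%:~R - n.+1%:R * x).
  by rewrite mulrBr mulKf ?gt_eqF.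
rewrite normrM gtr0_norm ?invr_gt0 // -[leRHS]mulr1 ler_wpM2l ?invr_ge0 ?(ltW n0) //.
by have := floor_itv (n.+1%:R * x); rewrite intrD => /andP[h1 h2]; rewrite ler_norml; lra.
Qed.

Lemma cvg_floor_approx (R : realType) (x : R) :
  (n.+1%:R^-1 * (Num.floor (n.+1%:R * x))%:~R @[n --> \oo] --> x)%classic.
Proof.
apply/cvgrPdist_le => e e0.
have := cvg_harmonic (R := R) => /cvgrPdist_le/(_ e e0); apply: filterS => n.
rewrite sub0r normrN /harmonic ger0_norm ?invr_ge0 ?ler0n // => le_e.
by rewrite distrC (le_trans (floor_approx _ _)).
Qed.

(** Take M = t M_n + N, where M_n rounds (n + 1) B down entrywise and t makes N negligible, so that
    M / (t (n + 1)) is close to B. *)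
Lemma cyclic_lattice_approx (R : realType) (d : nat) (B : 'M[R]_d.+1) (mu sigma : R) :
  `|\det B| = 1 -> 0 < mu -> covers B mu -> 1 < sigma ->
  exists (M : 'M[int]_d.+1) (r : 'cV[int]_d.+1) (nu : R),
    [/\ \det M != 0, cyclic_lattice M r, 0 < nu, covers (map_mx intr M) nu &
        nu ^+ d.+1 < (sigma * mu) ^+ d.+1 * `|\det M|%:~R].
Proof.
move=> detB mu0 cov sigma1.
have uB : B \in unitmx by rewrite unitmxE unitfE -normr_eq0 detB oner_eq0.
(* Of the factor sigma, s1 pays for the perturbed covering and sigma / s1 for the loss in the
   determinant. *)
pose s1 := (1 + sigma) / 2.
have s11 : 1 < s1 by rewrite /s1; lra.
have s1s : s1 < sigma by rewrite /s1; lra.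
(* Chosen so that 1 + 2 (d + 1) delta = s1, the factor in [covers_perturb]. *)
pose delta : R := (s1 - 1) / (d.+1%:R * 2).
have d0 : 0 < d.+1%:R :> R by rewrite ltr0n.
have delta0 : 0 < delta by rewrite divr_gt0 ?mulr_gt0 // subr_gt0.
(* [C] bounds the row sums of |B^-1|, so |B' - B| <= eta entrywise gives |B^-1 B' - 1| <= delta. *)
pose C := 1 + \sum_i \sum_j `|invmx B i j|.
have C0 : 0 < C by rewrite ltr_pwDl // sumr_ge0 // => i _; rewrite sumr_ge0.
pose eta := delta / C.
have eta0 : 0 < eta by rewrite divr_gt0.
have e2 : 0 < eta / 2 by rewrite divr_gt0.
pose Mn n : 'M[int]_d.+1 := \matrix_(i, j) Num.floor (n.+1%:R * B i j).
have cvgD : (`|\det (n.+1%:R^-1 *: map_mx intr (Mn n) : 'M[R]_d.+1)| @[n --> \oo]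
    --> `|\det B|)%classic.
  apply: cvg_norm; apply: cvg_det => i j.
  by under eq_fun do rewrite !mxE; apply: cvg_floor_approx.
rewrite detB in cvgD.
have kappa1 : (s1 / sigma) ^+ d.+1 < 1.
  have s1_ge0 : 0 <= s1 / sigma by rewrite divr_ge0; lra.
  by rewrite exprn_ilt1 // ltr_pdivrMr; lra.
have [n [nK ne]] : exists n, (s1 / sigma) ^+ d.+1 <
    `|\det (n.+1%:R^-1 *: map_mx intr (Mn n) : 'M[R]_d.+1)| /\ n.+1%:R^-1 <= eta / 2.
  have h1 := cvgr_gt _ cvgD _ kappa1.
  have h2 := cvgr_lt _ (cvg_harmonic (R := R)) _ e2.
  have [n [n1 n2]] := filter_ex (filterI (h1 _) (h2 _)).
  by exists n; split=> //; apply: ltW.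
have n0 : 0 < n.+1%:R :> R by rewrite ltr0n.
have [N NP] := cyclic_perturbation (Mn n).
(* For t > T the entries of N / t are at most eta / 2 in absolute value; rounding takes the other
   half of eta. *)
pose T : R := \sum_i \sum_j `|(N i j)%:~R| / (eta / 2).
pose t := (Num.truncn T).+1.
have t0 : 0 < t%:R :> R by rewrite ltr0n.
have tN i j : `|(N i j)%:~R| <= t%:R * (eta / 2) :> R.
  rewrite -ler_pdivrMr //; apply: (@le_trans _ _ T); last exact/ltW/truncnS_gt.
  rewrite /T (bigD1 i) //= (bigD1 j) //= -addrA lerDl addr_ge0 // sumr_ge0 // => k _.
    by rewrite divr_ge0 // divr_ge0 // ltW.
  by rewrite sumr_ge0 // => k' _; rewrite divr_ge0 // divr_ge0 // ltW.
have [detM [r rP]] := NP t%:R; set M := _ + N in detM rP.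
pose a : R := t%:R * n.+1%:R.
have a0 : 0 < a by rewrite mulr_gt0.
pose B' : 'M[R]_d.+1 := a^-1 *: map_mx intr M.
have BB' i j : `|(B' - B) i j| <= eta.
  have -> : (B' - B) i j = (n.+1%:R^-1 * (Num.floor (n.+1%:R * B i j))%:~R - B i j)
     + a^-1 * (N i j)%:~R.
    rewrite !mxE intrD intrM /a; field.
    by rewrite nat1r !gt_eqF.
  rewrite (le_trans (ler_normD _ _)) // [leRHS](splitr eta) lerD //.
    exact: le_trans (floor_approx _ _) ne.
  rewrite normrM gtr0_norm ?invr_gt0 // mulrC ler_pdivrMr //.
  rewrite (le_trans (tN i j)) // mulrC ler_pM2l // /a ler_peMr ?(ltW t0) //.
  by rewrite ler1n.
have dM0 : 0 < `|\det (Mn n)|%:~R :> R.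
  have : 0 < `|\det (n.+1%:R^-1 *: map_mx intr (Mn n) : 'M[R]_d.+1)|.
    by apply: le_lt_trans nK; rewrite exprn_ge0 // divr_ge0; lra.
  rewrite detZ normrM det_map_mx -intr_norm pmulr_rgt0 //.
  by rewrite normr_gt0 expf_neq0 // invr_neq0 // gt_eqF.
have detME : `|\det M|%:~R = t%:R ^+ d.+1 * `|\det (Mn n)|%:~R :> R.
  by rewrite detM normrM intrM normrX normr_nat rmorphXn /= mulrz_nat.
have detM0 : \det M != 0.
  by rewrite -normr_gt0 -(ltr0z R) detME mulr_gt0 // exprn_gt0.
exists M, r, (a * (mu * s1)); split=> //.
- by rewrite !mulr_gt0 //; lra.
- have -> : map_mx intr M = a *: B' by rewrite scalerA divff ?gt_eqF // scale1r.
  apply: covers_scale => //.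
  have -> : s1 = 1 + delta *+ d.+1 *+ 2.
    by rewrite -mulrnA -mulr_natr natrM /delta divfK ?mulf_neq0 ?pnatr_eq0 // addrC subrK.
  apply: (covers_perturb (B := B)) => //; first exact: ltW.
    rewrite unitmxE detZ det_map_mx unitfE mulf_neq0 ?intr_eq0 //.
    by rewrite expf_neq0 // invr_neq0 // gt_eqF.
  move=> i j; have -> : invmx B *m B' - 1%:M = invmx B *m (B' - B).
    by rewrite mulmxBr mulVmx.
  rewrite mxE (le_trans (ler_norm_sum _ _ _)) //.
  apply: (@le_trans _ _ (\sum_k `|invmx B i k| * eta)).
    by apply: ler_sum => k _; rewrite normrM ler_wpM2l.
  rewrite -mulr_suml /eta mulrCA -[leRHS]mulr1 ler_wpM2l ?(ltW delta0) //.
  rewrite ler_pdivrMr // mul1r /C [X in _ <= 1 + X](bigD1 i) //=.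
  by rewrite addrCA lerDl addr_ge0 // sumr_ge0 // => k _; rewrite sumr_ge0.
- rewrite detME [in ltLHS]/a.
  have sm0 : 0 < sigma ^+ d.+1 by rewrite exprn_gt0 //; lra.
  have nm0 : 0 < n.+1%:R ^+ d.+1 :> R by rewrite exprn_gt0.
  move: nK; rewrite detZ normrM det_map_mx -intr_norm exprVn normfV normrX normr_nat.
  rewrite expr_div_n ltr_pdivrMr // => nK.
  have {}nK : n.+1%:R ^+ d.+1 * s1 ^+ d.+1 < `|\det (Mn n)|%:~R * sigma ^+ d.+1.
    by rewrite -ltr_pdivlMl // mulrA.
  have p1 : 0 < t%:R ^+ d.+1 :> R by rewrite exprn_gt0.
  have p2 : 0 < mu ^+ d.+1 by rewrite exprn_gt0.
  have -> : (t%:R * n.+1%:R * (mu * s1)) ^+ d.+1 =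
    t%:R ^+ d.+1 * mu ^+ d.+1 * (n.+1%:R ^+ d.+1 * s1 ^+ d.+1) by rewrite !exprMn; ring.
  have -> : (sigma * mu) ^+ d.+1 * (t%:R ^+ d.+1 * `|\det (Mn n)|%:~R) =
    t%:R ^+ d.+1 * mu ^+ d.+1 * (`|\det (Mn n)|%:~R * sigma ^+ d.+1) by rewrite exprMn; ring.
  by rewrite ltr_pM2l // mulr_gt0.
Qed.

(* Cover the point r + (1 - theta)(1, ..., 1): integers above -1 are nonnegative. *)
Lemma covers_int_point (R : realType) (d : nat) (M : 'M[int]_d) (nu theta : R)
    (r : 'rV[int]_d) : covers (map_mx intr M) nu -> 0 < theta ->
  exists z : 'rV[int]_d, (forall i, 0 <= (r - z *m M) 0 i) /\
    (\sum_i (r - z *m M) 0 i)%:~R <= nu - d%:R + theta *+ d.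
Proof.
move=> cov theta0.
have [z [z0 z1]] := cov (map_mx intr r + const_mx (1 - theta)); exists z.
have E i : (map_mx intr r + const_mx (1 - theta) - map_mx intr z *m map_mx intr M) 0 i
   = ((r - z *m M) 0 i)%:~R + (1 - theta) :> R.
  by rewrite -map_mxM !mxE rmorphB /= addrAC.
split=> [i|].
  have := z0 i; rewrite E => h.
  have : ((-1)%:~R : R) < ((r - z *m M) 0 i)%:~R.
    by rewrite (_ : (-1)%:~R = -1 :> R) //; lra.
  by rewrite ltr_int; lia.
move: z1; under eq_bigr do rewrite E.
by rewrite big_split /= sumr_const card_ord -rmorph_sum /= mulrnBl; lra.
Qed.

(** * The knapsack problem attached to a cyclic lattice *)

Section CyclicKnapsack.
Context (d : nat) (M : 'M[int]_d.+1) (r : 'cV[int]_d.+1).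

(* The multiple of q is (d + 1) q because an optimal y has |y|_1 <= (d + 1) q. *)
Definition knapsack_row : 'rV[int]_d.+2 :=
  let q := `|\det M| in
  \row_i (if unlift ord0 i is Some j then d.+1%:Z * q * q + modz (r j 0) q else q).

Definition knapsack_cost : 'rV[rat]_d.+2 :=
  \row_i (if unlift ord0 i is Some j then 1 else 0).

Context (detM : \det M != 0) (cycM : cyclic_lattice M r).

Let q := `|\det M|.
Let K := d.+1%:Z * q.
Local Notation A := knapsack_row.

Let q0 : 0 < q. Proof. by rewrite normr_gt0. Qed.

Let A_0 : A 0 ord0 = q. Proof. by rewrite mxE unlift_none. Qed.

Let A_lift j : A 0 (lift ord0 j) = K * q + modz (r j 0) q.
Proof. by rewrite mxE liftK. Qed.

Lemma knapsack_row_gt0 i : 0 < A 0 i.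
Proof.
case: (unliftP ord0 i) => [j ->|->]; last by rewrite A_0.
rewrite A_lift ltr_pwDl ?modz_ge0 ?gt_eqF //.
by rewrite !mulr_gt0.
Qed.

(** A common divisor of the entries divides q and hence every r_j, so it divides u . r = 1. *)
Lemma knapsack_row_coprime : pos_coprime A.
Proof.
split; first exact: knapsack_row_gt0.
set k := (X in X = _); apply/eqP; rewrite -dvdn1.
have kA i : (k %| (A 0 i)%R)%Z by apply: (biggcdn_inf i).
have kq : (k %| q)%Z by have := kA ord0; rewrite A_0.
have kr j : (k %| (r j 0)%R)%Z.
  have := kA (lift ord0 j); rewrite A_lift rpredDl; last exact: dvdz_mull.
  move=> km; rewrite (divz_eq (r j 0) q) rpredDl //; exact: dvdz_mull.
have [[u ur] _] := cycM.
have : (k %| 1%R)%Z.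
  have <- : (u *m r) 0 0 = 1 by rewrite ur mxE.
  by rewrite mxE; apply: rpred_sum => j _; apply: dvdz_mull.
by [].
Qed.

Context (R : realType).

Lemma knapsack_redcost j : redcost R A knapsack_cost ord0 j = 1.
Proof. by rewrite redcostE mxE liftK mxE unlift_none rmorph0 !mul0r subr0 rmorph1. Qed.

Let l0 j : 0 < redcost R A knapsack_cost ord0 j.
Proof. by rewrite knapsack_redcost. Qed.

Lemma knapsack_generic : generic R A knapsack_cost.
Proof. exact: generic_redcost knapsack_row_gt0 l0. Qed.

Lemma knapsack_is_tau : is_tau R A knapsack_cost ord0.
Proof. exact: is_tau_redcost knapsack_row_gt0 l0. Qed.

Lemma knapsack_l1norm : l1norm R (lvec A knapsack_cost ord0) = d.+1%:R.
Proof.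
rewrite /l1norm (eq_bigr (fun _ => 1)) ?sumr_const ?card_ord // => j _.
by rewrite -/(redcost _ _ _ _ _) knapsack_redcost normr1.
Qed.

Lemma knapsack_geo_term : geo_term R A knapsack_cost ord0 = q%:~R `^ d.+1%:R^-1.
Proof.
rewrite /geo_term A_0 gtr0_norm ?ltr0z // big1 ?mulr1 // => j _.
by rewrite -/(redcost _ _ _ _ _) knapsack_redcost.
Qed.

Let weightE (y : 'cV[int]_d.+1) :
  weight R A knapsack_cost ord0 y = (\sum_j y j 0)%:~R.
Proof.
by rewrite /weight rmorph_sum; apply: eq_bigr => j _; rewrite knapsack_redcost mul1r.
Qed.

(** The covering gives y' in the class of an optimal y with |y'|_1 within the bound. If |y|_1 were
    larger, y' could be completed by a nonnegative entry at tau to a cheaper feasible point. *)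
Lemma knapsack_gap (nu theta : R) : covers (map_mx intr M) nu -> 0 < theta ->
  Gap R knapsack_cost A <= nu - d.+1%:R + theta *+ d.+1.
Proof.
move=> cov theta0.
have [[b [x0 [x0f <-]]] _] := GapP knapsack_row_gt0 l0.
have [|x [xf -> xmin]] := IG_opt knapsack_row_gt0 l0 (b := b); first by exists x0.
have x_lt := opt_lt knapsack_row_gt0 l0 xf xmin.
pose y := row' ord0 x; have yE j : y j 0 = x (lift ord0 j) 0 by rewrite mxE.
have [z [y'0 y'nu]] := covers_int_point y^T cov theta0.
pose y' := y^T - z *m M; rewrite -/y' in y'0 y'nu.
apply: le_trans y'nu; rewrite weightE ler_int leNgt; apply/negP => lt_y'y.
rewrite -/y in lt_y'y.
have [xb xpos] := (ip_feasibleE A ord0 b x).1 xf.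
(* The knapsack entries agree with r modulo q, and y - y' lies in the row lattice of M, on which r
   vanishes modulo q. *)
have [k kE] : exists k, \sum_j A 0 (lift ord0 j) * y j 0 -
    \sum_j A 0 (lift ord0 j) * y' 0 j = q * k.
  suff /dvdzP[k ->] : (q %| (\sum_j A 0 (lift ord0 j) * y j 0 -
    \sum_j A 0 (lift ord0 j) * y' 0 j)%R)%Z by exists k; rewrite mulrC.
  have -> : \sum_j A 0 (lift ord0 j) * y j 0 - \sum_j A 0 (lift ord0 j) * y' 0 j =
      (z *m M *m r) 0 0 + q * \sum_j (K - divz (r j 0) q) * (z *m M) 0 j.
    rewrite mxE mulr_sumr -sumrB -big_split /=; apply: eq_bigr => j _.
    rewrite [y' 0 j]mxE [y^T 0 j]mxE [(- (z *m M)) 0 j]mxE A_lift.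
    rewrite [in X in _ = _ * X + _](divz_eq (r j 0) q); ring.
  rewrite rpredDr; last exact: dvdz_mulr.
  rewrite -mulmxA mxE; apply: rpred_sum => i _; apply: dvdz_mull.
  by case: cycM => _ /(_ i); rewrite !dvdzE absz_id.
have le_y : \sum_j y j 0 <= K.
  rewrite /K -natz mulr_natl -[d.+1 in leRHS]card_ord -sumr_const ler_sum // => j _.
  by rewrite yE -A_0 ltW.
have y'_ge0 : 0 <= \sum_j y' 0 j by rewrite sumr_ge0.
(* With a = A_taubar: a . y' <= q (K + 1) |y'| <= q (K + 1) (|y| - 1) <= q K |y| <= a . y, using
   |y'| <= |y| - 1 and |y| <= K. *)
have k0 : 0 <= k.
  rewrite -(pmulr_rge0 _ q0) -kE subr_ge0.
  apply: (@le_trans _ _ (\sum_j (K * q + q) * y' 0 j)).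
    apply: ler_sum => j _; rewrite ler_wpM2r // A_lift lerD2l ltW //.
    by rewrite ltz_pmod.
  apply: (@le_trans _ _ (\sum_j (K * q) * y j 0)).
    have K0 : 0 <= K by rewrite /K mulr_ge0 // ltW.
    have -> : K * q + q = q * (K + 1) by ring.
    rewrite [K * q]mulrC -!mulr_sumr -[leLHS]mulrA -[leRHS]mulrA ler_pM2l //.
    have := ler_wpM2l (addr_ge0 K0 ler01) (_ : \sum_j y' 0 j <= \sum_j y j 0 - 1).
    rewrite lerBrDr -ltzD1 ltrD2r => /(_ lt_y'y)/le_trans; apply.
    by rewrite mulrBr mulr1 mulrDl mul1r -addrA gerDl subr_le0 ler_wpDr.
  apply: ler_sum => j _; rewrite ler_wpM2r ?yE // A_lift lerDl modz_ge0 //.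
  by rewrite gt_eqF.
pose x' : 'cV[int]_d.+2 :=
  \col_i (if unlift ord0 i is Some j then y' 0 j else x ord0 0 + k).
have x'f : ip_feasible A b x'.
  apply/(ip_feasibleE A ord0); split.
    rewrite [x' ord0 0]mxE unlift_none (eq_bigr (fun j => A 0 (lift ord0 j) * y' 0 j)).
      rewrite -xb A_0 mulrDr -kE; under [in RHS]eq_bigr do rewrite -yE; ring.
    by move=> j _; rewrite [x' _ _]mxE liftK.
  move=> i; rewrite mxE; case: (unliftP ord0 i) => [j _|_] //.
  by rewrite addr_ge0.
have := xmin _ x'f; rewrite !weightE ler_int leNgt.
rewrite (eq_bigr (fun j => y' 0 j)) ?lt_y'y // => j _.
by rewrite !mxE liftK !mxE.
Qed.

End CyclicKnapsack.

(** * Optimality of the covering constant and conclusion *)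

Lemma rho_has_inf (R : realType) (d : nat) : has_inf
  [set covering_radius (@std_simplex R d) L | L in @lattice_of_det R d 1]%classic.
Proof.
split; last exact: rho_has_lbound.
exists (covering_radius (@std_simplex R d) (lattice_of 1%:M)), (lattice_of 1%:M) => //.
by exists 1%:M; rewrite unitmx1 det1 normr1.
Qed.

(** A lattice of determinant 1 and covering radius mu < rho + eps is approximated with sigma = (rho
    + eps) / mu, which yields nu < (rho + eps) g. *)
Lemma Gap_lt_rho (R : realType) (d : nat) (eps : R) : 0 < eps ->
  exists (A : 'rV[int]_d.+2) (c : 'rV[rat]_d.+2) (tau : 'I_d.+2),
    [/\ pos_coprime A, generic R A c, is_tau R A c tau &
      Gap R c A < (rho R d.+1 + eps) * geo_term R A c tau - l1norm R (lvec A c tau)].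
Proof.
move=> eps0; have [_ [_ [B [uB detB ->]] <-]] := inf_adherent eps0 (rho_has_inf R d.+1).
rewrite -/(rho R d.+1) => lt_rho.
have [mu0 cov] := covering_radiusP (ltn0Sn d) uB.
set mu := covering_radius _ _ in lt_rho mu0 cov.
have sigma1 : 1 < (rho R d.+1 + eps) / mu by rewrite ltr_pdivlMr // mul1r.
have [M [r [nu [detM cycM nu0 covM]]]] := cyclic_lattice_approx detB mu0 cov sigma1.
rewrite divfK ?gt_eqF // => nu_lt.
exists (knapsack_row M r), (knapsack_cost d), ord0.
split.
- exact: knapsack_row_coprime.
- exact: knapsack_generic.
- exact: knapsack_is_tau.
rewrite knapsack_l1norm knapsack_geo_term //.
set g := _ `^ _.
have q0 : 0 < `|\det M|%:~R :> R by rewrite ltr0z normr_gt0.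
have g0 : 0 < g by rewrite powR_gt0.
have gd : g ^+ d.+1 = `|\det M|%:~R.
  by rewrite -powR_mulrn ?ltW // -powRrM mulVf ?pnatr_eq0 // powRr1 // ltW.
have rho0 : 0 < rho R d.+1 + eps by apply: lt_trans lt_rho.
have lt_nu : nu < (rho R d.+1 + eps) * g.
  by rewrite -(ltr_pXn2r (ltn0Sn d)) ?nnegrE ?mulr_ge0 ?ltW // exprMn gd.
(* Makes theta (d + 1) half of the slack (rho + eps) g - nu, which keeps the final inequality
   strict. *)
pose theta : R := ((rho R d.+1 + eps) * g - nu) / (d.+1%:R * 2).
have theta0 : 0 < theta by rewrite divr_gt0 ?subr_gt0 ?mulr_gt0.
apply: (le_lt_trans (knapsack_gap detM cycM covM theta0)).
have -> : theta *+ d.+1 = ((rho R d.+1 + eps) * g - nu) / 2.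
  by rewrite -mulr_natr /theta; field; rewrite nat1r pnatr_eq0.
lra.
Qed.

Theorem theorem2 (R : realType) (n : nat) (hn : (2 <= n)%N) :
  (forall (A : 'rV[int]_n) (c : 'rV[rat]_n),
     pos_coprime A -> generic R A c ->
     forall tau : 'I_n, is_tau R A c tau ->
       rho R n.-1 * geo_term R A c tau - l1norm R (lvec A c tau) <= Gap R c A)
  /\
  (forall eps : R, 0 < eps ->
     exists (A : 'rV[int]_n) (c : 'rV[rat]_n) (tau : 'I_n),
       [/\ pos_coprime A, generic R A c, is_tau R A c tau &
         Gap R c A <
           (rho R n.-1 + eps) * geo_term R A c tau - l1norm R (lvec A c tau)]).
Proof.
case: n hn => [|[|d]] // _; split; last exact: Gap_lt_rho.
by move=> A c posA gen tau tauP; apply: Gap_ge_rho.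
Qed.
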